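(* Let $N,\tau,\gamma,\xi,q,f,\phi_1,\phi_2$ be as in the context, and let $(\pi^{(\ell)},z^{(\ell)})$ be the iterates of Dykstra's algorithm for the KL divergence: $\pi^{(0)}=\xi$, $z^{(0)}=z^{(-1)}=\mathbf{1}\mathbf{1}^T$ and, for $\ell>0$, $$\pi^{(\ell)}=\mathrm{Prox}^{\mathrm{KL}}_{\phi_{[\ell]_2}}(\pi^{(\ell-1)}\odot z^{(\ell-2)}),\qquad z^{(\ell)}=z^{(\ell-2)}\odot\frac{\pi^{(\ell-1)}}{\pi^{(\ell)}} .$$ Then these iterates can be written as $$\pi^{(\ell)}=\mathrm{diag}(a^{(\ell)})\,\xi\,\mathrm{diag}(b^{(\ell)})\qquad\text{and}\qquad z^{(\ell)}=u^{(\ell)}\,(v^{(\ell)})^{T},$$ where $a^{(\ell)},b^{(\ell)},u^{(\ell)},v^{(\ell)}\in\mathbb{R}^N$ have strictly positive entries and are given by the initialization $a^{(0)}=b^{(0)}=u^{(0)}=v^{(0)}=\mathbf{1}$, $u^{(-1)}=v^{(-1)}=\mathbf{1}$, and the following updates for $\ell>0$. For odd $\ell$, $$a^{(\ell)}=a^{(\ell-1)}\odot u^{(\ell-2)},\qquad b^{(\ell)}=\frac{q}{\xi^T a^{(\ell)}} ;$$ for even $\ell$, $$b^{(\ell)}=b^{(\ell-1)}\odot v^{(\ell-2)},\qquad a^{(\ell)}=\frac{p^{(\ell)}}{\xi\, b^{(\ell)}},\qquad\text{where}\quad p^{(\ell)}=\mathrm{Prox}^{\overline{\mathrm{KL}}}_{\frac{\tau}{\gamma}f}\big(a^{(\ell-1)}\odot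 u^{(\ell-2)}\odot(\xi\, b^{(\ell)})\big);$$ and for all $\ell>0$, $$u^{(\ell)}=u^{(\ell-2)}\odot\frac{a^{(\ell-1)}}{a^{(\ell)}},\qquad v^{(\ell)}=v^{(\ell-2)}\odot\frac{b^{(\ell-1)}}{b^{(\ell)}} .$$
   Context: $\mathbf{1}=(1,\dots,1)^T\in\mathbb{R}^N$; $\odot$ and fractions denote entrywise product and division; $[\ell]_2=1$ if $\ell$ is odd, $2$ if $\ell$ is even. $c\in\mathbb{R}^{N\times N}$ is a cost matrix, $\tau,\gamma>0$, and $\xi=e^{-c/\gamma}$ (entrywise exponential, so $\xi$ has strictly positive entries). $q\in\mathbb{R}_+^N$ with $\sum_i q_i=1$; $f:\mathbb{R}^N\to(-\infty,+\infty]$ is a proper lower semicontinuous convex function; $\phi_1(\pi)=0$ if $\pi^T\mathbf{1}=q$ and $+\infty$ otherwise; $\phi_2(\pi)=\frac{\tau}{\gamma}f(\pi\mathbf{1})$. Standing qualification assumption: $\mathrm{ri}(\mathrm{dom}\,\phi_1)\cap\mathrm{ri}(\mathrm{dom}\,\phi_2)\cap\mathrm{ri}(\mathbb{R}_+^{N\times N})\neq\emptyset$, where $\mathrm{ri}$ is the relative interior and $\mathrm{dom}\,\phi=\{\phi\ne+\infty\}$. With the convention $0\log0=0$, $$\overline{\mathrm{KL}}(p|r)=\sum_i p_i\log(p_i/r_i)-p_i+r_i,\qquad \mathrm{KL}(\pi|\zeta)=\sum_{i,j}\pi_{i,j}\log(\pi_{i,j}/\zeta_{i,j})-\pi_{i,j}+\zeta_{i,j},$$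 for first argument nonnegative and second argument strictly positive, and $$\mathrm{Prox}^{\overline{\mathrm{KL}}}_{g}(r)=\mathrm{argmin}_{p\in\mathbb{R}_+^N}\overline{\mathrm{KL}}(p|r)+g(p),\qquad \mathrm{Prox}^{\mathrm{KL}}_{\phi}(\pi)=\mathrm{argmin}_{\tilde\pi\in\mathbb{R}_+^{N\times N}}\mathrm{KL}(\tilde\pi|\pi)+\phi(\tilde\pi).$$ *)

(* Defs.v *)
From HB Require Import structures.
From mathcomp Require Import all_boot all_order all_algebra.
From mathcomp Require Import all_classical all_reals all_analysis.

Set Implicit Arguments.
Unset Strict Implicit.
Unset Printing Implicit Defensive.

Import Order.TTheory GRing.Theory Num.Theory.
Import numFieldNormedType.Exports.

Local Open Scope classical_set_scope.
Local Open Scope ring_scope.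

Notation "A ⊙ B" := (map2_mx *%R A B)
  (at level 40, left associativity) : ring_scope.
Notation "A ⊘ B" := (map2_mx (fun x y => x / y) A B)
  (at level 40, left associativity) : ring_scope.

(* Vectors of R^N are column matrices, so that the definitions below, stated
   for 'M[R]_(m, n), cover both R^N (m = N, n = 1) and R^(N x N). *)

Definition mx_pos (R : realType) (m n : nat) (A : 'M[R]_(m, n)) : Prop :=
  forall i j, 0 < A i j.

Definition mx_orthant (R : realType) (m n : nat) : set 'M[R]_(m, n) :=
  [set A | forall i j, 0 <= A i j].

Definition effective_domain (T : Type) (R : realType) (g : T -> \bar R) :
  set T := [set x | g x != +oo%E].

Definition proper_function (T : Type) (R : realType) (g : T -> \bar R) : Prop :=
  (forall x, g x != -oo%E) /\ effective_domain g !=set0.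

(* The library's [convex_function] only covers real-valued functions. There is
   no indeterminate sum here as long as g never takes the value -oo. *)
Definition convex_efunction (R : realType) (m n : nat)
    (g : 'M[R]_(m, n) -> \bar R) : Prop :=
  forall (x y : 'M[R]_(m, n)) (t : R), 0 <= t <= 1 ->
    (g (t *: x + (1 - t) *: y)%R <= t%:E * g x + (1 - t)%:E * g y)%E.

Definition affine_hull (R : realType) (m n : nat) (C : set 'M[R]_(m, n)) :
    set 'M[R]_(m, n) :=
  [set x | exists (k : nat) (w : 'I_k -> R) (y : 'I_k -> 'M[R]_(m, n)),
     [/\ forall i, C (y i), \sum_i w i = 1 & x = \sum_i w i *: y i]].

Definition relative_interior (R : realType) (m n : nat)
    (C : set 'M[R]_(m, n)) : set 'M[R]_(m, n) :=
  [set x | C x /\ \forall y \near x, affine_hull C y -> C y].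

(* 0 log 0 = 0 holds because the product with 0 is 0. Meaningful for p
   nonnegative and r positive. *)
Definition KL (R : realType) (m n : nat) (p r : 'M[R]_(m, n)) : R :=
  \sum_i \sum_j (p i j * ln (p i j / r i j) - p i j + r i j).

Definition argmin (T : Type) (R : realType) (A : set T) (F : T -> \bar R) :
  set T := [set x | A x /\ forall y, A y -> (F x <= F y)%E].

(* The unique minimizer; the value is 0 when there is not exactly one. *)
Definition prox_KL (R : realType) (m n : nat) (g : 'M[R]_(m, n) -> \bar R)
    (r : 'M[R]_(m, n)) : 'M[R]_(m, n) :=
  xget 0 [set p | argmin (@mx_orthant R m n)
                         (fun p' => ((KL p' r)%:E + g p')%E) = [set p]].

Definition phi1 (R : realType) (N : nat) (q : 'cV[R]_N) (P : 'M[R]_N) : \bar R :=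
  if P^T *m const_mx 1 == q then 0%E else +oo%E.

Definition phi2 (R : realType) (N : nat) (tau gamma : R)
    (f : 'cV[R]_N -> \bar R) (P : 'M[R]_N) : \bar R :=
  ((tau / gamma)%:E * f (P *m const_mx 1)%R)%E.

(* The correction matrices z start at index -1, hence are indexed by int (their
   values at indices below -1 are irrelevant). *)
Definition dykstra_iterates (R : realType) (N : nat)
    (g1 g2 : 'M[R]_N -> \bar R) (xi : 'M[R]_N)
    (P : nat -> 'M[R]_N) (z : int -> 'M[R]_N) : Prop :=
  [/\ P 0%N = xi,
      z 0 = const_mx 1,
      z (-1) = const_mx 1
    & forall l : nat, (0 < l)%N ->
        P l = prox_KL (if odd l then g1 else g2) (P l.-1 ⊙ z (l%:Z - 2))
        /\ z l%:Z = z (l%:Z - 2) ⊙ (P l.-1 ⊘ P l)].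

(* Main.v *)
Require Import Defs.
From HB Require Import structures.
From mathcomp Require Import all_boot all_order all_algebra.
From mathcomp Require Import all_classical all_reals all_analysis.
From mathcomp Require Import ring lra.

Set Implicit Arguments.
Unset Strict Implicit.
Unset Printing Implicit Defensive.

Import Order.TTheory GRing.Theory Num.Theory.
Import numFieldNormedType.Exports.

Local Open Scope classical_set_scope.
Local Open Scope ring_scope.

(** The algorithm alternates two proximal maps of the KL divergence, and both
only rescale their argument. Projecting [r] onto the matrices with column sums
[q] multiplies each column by a constant; penalizing a function [g] of the row
sums multiplies each row by a constant, chosen so that the new row sums are the
proximal point of [g] at the old ones. Hence if the current iterate is
[diag a * xi * diag b] and the correction is [u v^T], then the argument of the
next map, their entrywise product, is again a scaling of [xi], with vectors
[a u] and [b v], and so is the next iterate; the quotient of two scalings of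
[xi] has rank one, which gives the next correction.

That these rescalings are the proximal points is a first-order argument. The
divergence satisfies the three-point identity [KL_expansion]:
[KL p' r = KL p' p + KL p r + <p' - p, log (p / r)>]. So if [p] is positive and
[g p' >= g p - <p' - p, log (p / r)>] for all nonnegative [p'], then [p]
minimizes [KL (.) r + g], and it is the only minimizer since [KL p' p] vanishes
only at [p' = p] ([prox_KL_first_order]). For a rescaled matrix [log (p / r)]
depends on the column or on the row only. In the first case the pairing
vanishes on matrices with the prescribed column sums ([prox_phi1]); in the
second it equals the pairing of the row sums, so the condition is inherited
from the vector problem ([prox_row_sums]).

It remains to know that the vector problem has a solution, that the solution is
positive and that it satisfies the first-order condition
([prox_KL_gt0_first_order]). Existence: a convex lower semicontinuous [g] that
is finite somewhere grows at worst linearly towards minus infinity, while the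
divergence grows faster than every linear function, so the problem reduces to a
compact box. Positivity: the qualification assumption provides a positive
vector where [g] is finite, and the slope of [x log x] at 0 is minus infinity,
so moving a minimizer with a vanishing entry towards that vector would improve
it ([argmin_KL_gt0]). The first-order condition then follows by differentiating
along segments ([argmin_KL_first_order]). *)

(** * The scalar divergence *)

Definition kl (R : realType) (x r : R) : R := x * ln (x / r) - x + r.

Lemma kl0l (R : realType) (r : R) : kl 0 r = r.
Proof. by rewrite /kl mul0r subr0 add0r. Qed.

(** The affine minorants of the divergence; the one of slope [K] touches it at
[x = r * expR K]. *)
Lemma kl_fenchel (R : realType) (K x r : R) : 0 <= x -> 0 < r ->
  K * x - r * (expR K - 1) <= kl x r.
Proof.
rewrite le_eqVlt => /predU1P[<-|x0] r0.
  rewrite kl0l; have := mulr_gt0 r0 (expR_gt0 K); nra.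
have xr0 : 0 < x / r by rewrite divr_gt0.
have e : r * expR K = x * expR (K - ln (x / r)).
  by rewrite expRB lnK//; field; rewrite !gt_eqF.
have := expR_ge1Dx (K - ln (x / r)).
rewrite -(ler_pM2l x0) -e /kl; lra.
Qed.

Lemma kl_ge0 (R : realType) (x r : R) : 0 <= x -> 0 < r -> 0 <= kl x r.
Proof.
move=> x0 r0; have := kl_fenchel 0 x0 r0.
by rewrite expR0 subrr mulr0 mul0r subr0.
Qed.

Lemma kl_eq0 (R : realType) (x r : R) : 0 <= x -> 0 < r -> kl x r <= 0 -> x = r.
Proof.
rewrite le_eqVlt => /predU1P[<-|x0] r0.
  by rewrite kl0l leNgt r0.
move=> k0; apply/eqP/negPn/negP => xr.
have rx0 : 0 < r / x by rewrite divr_gt0.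
have l0 : ln (r / x) != 0.
  rewrite ln_eq0// -[1](divff (lt0r_neq0 x0)).
  by apply: contra xr => /eqP /(mulIf _) ->; rewrite // invr_eq0 gt_eqF.
have := expR_gt1Dx l0; rewrite lnK// -(ltr_pM2l x0) mulrCA divff ?gt_eqF// mulr1.
move: k0; rewrite /kl -[x / r]invf_div lnV//; lra.
Qed.

(** The first-order expansion of the divergence at [m]; its remainder is again
a divergence. *)
Lemma kl_expansion (R : realType) (x m r : R) : 0 <= x -> 0 < m -> 0 < r ->
  kl x r = kl x m + kl m r + (x - m) * ln (m / r).
Proof.
rewrite le_eqVlt => /predU1P[<-|x0] m0 r0; first by rewrite !kl0l /kl; lra.
by rewrite /kl !ln_div//; lra.
Qed.

Lemma kl_le_sqr (R : realType) (x y : R) : 0 <= x -> 0 < y ->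
  kl x y <= (x - y) ^+ 2 / y.
Proof.
move=> x0 y0.
have e : (x - y) ^+ 2 / y = x * (x / y - 1) - x + y.
  by field; rewrite gt_eqF.
rewrite e /kl lerD2r lerD2r.
move: x0; rewrite le_eqVlt => /predU1P[<-|x0]; first by rewrite !mul0r.
rewrite ler_pM2l//.
have /le_ln1Dx : -1 < x / y - 1 by rewrite ltrBrDr addNr divr_gt0.
by rewrite addrC subrK.
Qed.

(** Convexity, read off the affine minorant touching the divergence at the
intermediate point. *)
Lemma kl_convex (R : realType) (x y r t : R) :
    0 <= x -> 0 <= y -> 0 < r -> 0 < t -> t < 1 ->
  kl (t * x + (1 - t) * y) r <= t * kl x r + (1 - t) * kl y r.
Proof.
move=> x0 y0 r0 t0 t1; set m := t * x + _.
have [m0|m0] := leP m 0.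
  have tx : 0 <= t * x by rewrite mulr_ge0// ltW.
  have ty : 0 <= (1 - t) * y by rewrite mulr_ge0// subr_ge0 ltW.
  have tx0 : t * x = 0 by move: m0; rewrite /m; lra.
  have ty0 : (1 - t) * y = 0 by move: m0; rewrite /m; lra.
  have xE : x = 0.
    by move/eqP: tx0; rewrite mulf_eq0 gt_eqF//= => /eqP.
  have yE : y = 0.
    by move/eqP: ty0; rewrite mulf_eq0 subr_eq0 gt_eqF//= => /eqP.
  by rewrite /m xE yE !mulr0 addr0 !kl0l; lra.
have := @kl_ge0 _ _ _ x0 m0; have := @kl_ge0 _ _ _ y0 m0.
rewrite (@kl_expansion _ x m r)// (@kl_expansion _ y m r)//.
have: t * (x - m) + (1 - t) * (y - m) = 0 by rewrite /m; ring.
move: (ln _) => L; move: (kl m r) (kl x m) (kl y m) => A B C.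
move=> e hC hB.
have -> : t * (B + A + (x - m) * L) + (1 - t) * (C + A + (y - m) * L) =
  A + t * B + (1 - t) * C + (t * (x - m) + (1 - t) * (y - m)) * L by ring.
rewrite e; have := mulr_ge0 (ltW t0) hB.
have : 0 <= (1 - t) * C by rewrite mulr_ge0// subr_ge0 ltW.
lra.
Qed.

(** On the ray from the boundary point 0, the divergence differs from its chord
by the term [t * x * ln t], which is negative for [t < 1] and dominates every
multiple of [t] near 0. *)
Lemma kl_scalel (R : realType) (x r t : R) : 0 < x -> 0 < r -> 0 < t ->
  kl (t * x) r = t * kl x r + (1 - t) * kl 0 r + t * x * ln t.
Proof.
by move=> x0 r0 t0; rewrite kl0l /kl -[t * x / r]mulrA lnM ?posrE ?divr_gt0//; ring.
Qed.

(** At the boundary point 0 no affine minorant is exact, but their supremum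
is, which is all that lower semicontinuity needs. *)
Lemma kl_lsc (R : realType) (x r a : R) : 0 <= x -> 0 < r -> a < kl x r ->
  \forall y \near x, 0 <= y -> a < kl y r.
Proof.
move=> x0 r0 ax.
have [K hK] : exists K, a < K * x - r * (expR K - 1).
  move: x0 ax; rewrite le_eqVlt => /predU1P[<-|x0] ax.
    rewrite kl0l in ax; exists (ln ((r - a) / (2 * r))).
    rewrite lnK ?posrE ?divr_gt0 ?subr_gt0 ?mulr_gt0//.
    have -> : r * ((r - a) / (2 * r) - 1) = (r - a) / 2 - r.
      by field; rewrite gt_eqF.
    by lra.
  exists (ln (x / r)); rewrite lnK ?posrE ?divr_gt0//.
  have -> : r * (x / r - 1) = x - r by field; rewrite gt_eqF.
  by move: ax; rewrite /kl; lra.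
have cK : (fun y => K * y - r * (expR K - 1)) @ x --> K * x - r * (expR K - 1).
  by apply: cvgB; [apply: cvgMr; exact: cvg_id|exact: cvg_cst].
have := @cvgr_gt _ _ _ (nbhs_filter x) _ _ cK _ hK.
apply: filterS => y hy y0; exact: lt_le_trans hy (kl_fenchel K y0 r0).
Qed.

(** * The divergence of matrices *)

Lemma KLE (R : realType) (m n : nat) (p r : 'M[R]_(m, n)) :
  KL p r = \sum_i \sum_j kl (p i j) (r i j).
Proof. by []. Qed.

Lemma ler_sum2 (R : realType) (m n : nat) (F G : 'I_m -> 'I_n -> R) :
  (forall i j, F i j <= G i j) ->
  \sum_i \sum_j F i j <= \sum_i \sum_j G i j.
Proof. by move=> FG; apply: ler_sum => i _; apply: ler_sum. Qed.

Lemma ler_sum2_term (R : realType) (m n : nat) (F : 'I_m -> 'I_n -> R)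
    (i : 'I_m) (j : 'I_n) :
  (forall i j, 0 <= F i j) -> F i j <= \sum_i \sum_j F i j.
Proof.
move=> F0; rewrite (bigD1 i)//= (bigD1 j)//= -addrA lerDl addr_ge0//.
  exact: sumr_ge0.
by apply: sumr_ge0 => k _; exact: sumr_ge0.
Qed.

Lemma KL_ge0 (R : realType) (m n : nat) (p r : 'M[R]_(m, n)) :
  mx_orthant p -> mx_pos r -> 0 <= KL p r.
Proof.
move=> p0 r0; apply: sumr_ge0 => i _; apply: sumr_ge0 => j _; exact: kl_ge0.
Qed.

Lemma KL_eq0 (R : realType) (m n : nat) (p r : 'M[R]_(m, n)) :
  mx_orthant p -> mx_pos r -> KL p r <= 0 -> p = r.
Proof.
move=> p0 r0 k0; apply/matrixP => i j; apply: kl_eq0 => //.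
apply: le_trans k0; rewrite KLE.
by apply: (@ler_sum2_term _ _ _ (fun i j => kl (p i j) (r i j))) => *; exact: kl_ge0.
Qed.

(** The directional derivative at [m], in direction [p - m], of the divergence
from [r]. *)
Definition KL_slope (R : realType) (k n : nat) (m r p : 'M[R]_(k, n)) : R :=
  \sum_i \sum_j (p i j - m i j) * ln (m i j / r i j).

Lemma KL_expansion (R : realType) (k n : nat) (p m r : 'M[R]_(k, n)) :
  mx_orthant p -> mx_pos m -> mx_pos r ->
  KL p r = KL p m + KL m r + KL_slope m r p.
Proof.
move=> p0 m0 r0; rewrite !KLE /KL_slope -!big_split/=.
apply: eq_bigr => i _; rewrite -!big_split/=.
by apply: eq_bigr => j _; exact: kl_expansion.
Qed.

Lemma prox_KLE (R : realType) (m n : nat) (g : 'M[R]_(m, n) -> \bar R)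
    (r p : 'M[R]_(m, n)) :
  argmin (@mx_orthant R m n) (fun p' => ((KL p' r)%:E + g p')%E) = [set p] ->
  prox_KL g r = p.
Proof.
move=> pE; rewrite /prox_KL; apply: xget_unique => //= p' /=.
by rewrite pE => /seteqP[/(_ p erefl)].
Qed.

(** The first-order condition at a positive point determines the proximal
point: by the expansion of the divergence at [p], the objective at [p'] exceeds
the one at [p] by at least the divergence from [p] to [p'], which also gives
uniqueness. *)
Lemma prox_KL_first_order (R : realType) (m n : nat)
    (g : 'M[R]_(m, n) -> \bar R) (r p : 'M[R]_(m, n)) (s : R) :
    mx_pos r -> mx_pos p -> g p = s%:E ->
    (forall p', mx_orthant p' -> ((s - KL_slope p r p')%:E <= g p')%E) ->
  prox_KL g r = p.
Proof.
move=> r0 p0 gp first_order.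
have p_ge0 : mx_orthant p by move=> i j; exact: ltW.
have gap p' : mx_orthant p' ->
    ((KL p r + s + KL p' p)%:E <= (KL p' r)%:E + g p')%E.
  move=> p'0; apply: le_trans (leeD2l _ (first_order _ p'0)).
  by rewrite -EFinD lee_fin (KL_expansion p'0 p0 r0); lra.
apply: prox_KLE; apply/seteqP; split => [p' [p'0 /(_ _ p_ge0)]|_ ->] /=.
  move=> /(le_trans (gap _ p'0)); rewrite gp -EFinD lee_fin => h.
  by apply: KL_eq0 => //; move: h; lra.
split=> // p' p'0; apply: le_trans (gap _ p'0).
by rewrite gp -EFinD lee_fin lerDl KL_ge0.
Qed.

(** * Minimizers of a convex perturbation of the divergence *)

Section minimizer.
Context (R : realType) (m n : nat) (g : 'M[R]_(m, n) -> \bar R).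
Context (r p : 'M[R]_(m, n)) (s : R).
Context (r0 : mx_pos r) (p_ge0 : mx_orthant p) (gp : g p = s%:E).
Context (p_min : argmin (@mx_orthant R m n)
  (fun p' => ((KL p' r)%:E + g p')%E) p).
Context (g_convex : convex_efunction g).

Let segment_min p' s' t : mx_orthant p' -> g p' = s'%:E -> 0 < t -> t < 1 ->
  KL p r + s <= KL (t *: p' + (1 - t) *: p) r + (t * s' + (1 - t) * s).
Proof.
move=> p'0 gp' t0 t1.
have t01 : 0 <= t <= 1 by rewrite !ltW.
have pt0 : mx_orthant (t *: p' + (1 - t) *: p).
  by move=> i j; rewrite !mxE addr_ge0// mulr_ge0// ?subr_ge0 ltW.
rewrite -lee_fin !EFinD -gp; case: p_min => _ /(_ _ pt0) /le_trans; apply.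
rewrite leeD2l//; have := g_convex p' p t01; rewrite gp gp'.
by rewrite -!EFinM.
Qed.

(** If an entry of [p] vanished, moving towards a positive point at distance
[t] would change the objective by at most [t * (const + x * ln t)] with [x > 0],
which is negative for small [t]. *)
Lemma argmin_KL_gt0 (x : 'M[R]_(m, n)) (sx : R) :
  mx_pos x -> g x = sx%:E -> mx_pos p.
Proof.
move=> x0 gx i0 j0; rewrite lt_neqAle p_ge0 andbT eq_sym; apply/negP => /eqP p0.
have x_ge0 : mx_orthant x by move=> i j; exact: ltW.
have key t : 0 < t -> t < 1 ->
    KL p r + s - KL x r - sx <= x i0 j0 * ln t.
  move=> t0 t1; have t1' : 0 < 1 - t by rewrite subr_gt0.
  have := segment_min x_ge0 gx t0 t1.
  set pt := t *: x + _.
  pose D i j := t * kl (x i j) (r i j) + (1 - t) * kl (p i j) (r i j)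
     - kl (pt i j) (r i j).
  have D0 i j : 0 <= D i j by rewrite /D subr_ge0 /pt !mxE; exact: kl_convex.
  have := ler_sum2_term i0 j0 D0.
  have -> : \sum_i \sum_j D i j = t * KL x r + (1 - t) * KL p r - KL pt r.
    rewrite !KLE !mulr_sumr -sumrN -!big_split/=; apply: eq_bigr => i _.
    by rewrite !mulr_sumr -sumrN -!big_split/=.
  rewrite /D /pt !mxE p0 mulr0 addr0 kl_scalel// => h1 h2.
  by rewrite -(ler_pM2l t0); move: h1 h2; lra.
(* This t makes x i0 j0 * ln t equal to -(|d| + 1), which is less than d. *)
pose d := KL p r + s - KL x r - sx.
have d1 : 0 < `|d| + 1 by rewrite ltr_wpDl.
have := key (expR (- ((`|d| + 1) / x i0 j0))) (expR_gt0 _).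
rewrite expR_lt1 oppr_lt0 divr_gt0// => /(_ isT).
rewrite expRK mulrN mulrCA divff ?gt_eqF// mulr1 -/d.
have := ler_norm (- d); rewrite normrN; lra.
Qed.

(** Divide the increase of the objective on a segment of length [t] by [t]: the
remainder of the expansion of the divergence at [p] is at most quadratic in [t],
and disappears as [t] goes to 0. *)
Lemma argmin_KL_first_order :
  mx_pos p -> (forall x, g x != -oo%E) ->
  forall p', mx_orthant p' -> ((s - KL_slope p r p')%:E <= g p')%E.
Proof.
move=> p0 gNoo p' p'0; case gp' : (g p') => [s'| |]; last 2 first.
- by rewrite leey.
- by have := gNoo p'; rewrite gp'.
rewrite lee_fin lerBlDr.
pose Q := \sum_i \sum_j (p' i j - p i j) ^+ 2 / p i j.
have Q0 : 0 <= Q.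
  by apply: sumr_ge0 => i _; apply: sumr_ge0 => j _; rewrite divr_ge0 ?sqr_ge0// ltW.
have key t : 0 < t -> t < 1 -> s <= s' + KL_slope p r p' + t * Q.
  move=> t0 t1; have := segment_min p'0 gp' t0 t1.
  set pt := t *: p' + _.
  have pt0 : mx_orthant pt.
    by move=> i j; rewrite !mxE addr_ge0// mulr_ge0// ?subr_ge0 ltW.
  rewrite (KL_expansion pt0 p0 r0).
  have -> : KL_slope p r pt = t * KL_slope p r p'.
    rewrite /KL_slope mulr_sumr; apply: eq_bigr => i _; rewrite mulr_sumr.
    by apply: eq_bigr => j _; rewrite !mxE; ring.
  have : KL pt p <= t * (t * Q).
    rewrite /Q !mulr_sumr; apply: ler_sum => i _; rewrite !mulr_sumr.
    apply: ler_sum => j _; apply: le_trans (kl_le_sqr _ _) _ => //.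
    rewrite le_eqVlt; apply/orP; left; apply/eqP; rewrite !mxE.
    by field; rewrite gt_eqF.
  by move=> h1 h2; rewrite -(ler_pM2l t0); move: h1 h2; lra.
rewrite leNgt; apply/negP => d0.
(* With deficit d > 0, this t in ]0, 1[ satisfies t * Q < d. *)
pose d := s - (s' + KL_slope p r p'); have {}d0 : 0 < d by rewrite subr_gt0.
have dQ : 0 < d + Q + 1 by rewrite addr_gt0// ltr_wpDr.
have := key (d / (d + Q + 1)).
rewrite divr_gt0// ltr_pdivrMr// mul1r => /(_ isT).
have -> : d < d + Q + 1 by lra.
move=> /(_ isT); rewrite -lerBlDl -/d leNgt => /negP; apply.
rewrite mulrAC ltr_pdivrMr// ltr_pM2l//; lra.
Qed.

End minimizer.

(** * Existence of the proximal point *)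

Lemma lt_ereal_dense (R : realType) (x y : \bar R) :
  (x < y)%E -> exists2 a : R, (x <= a%:E)%E & (a%:E < y)%E.
Proof.
case: x y => [x| |] [y| |]//= xy.
- by exists x.
- by exists x; rewrite ?ltry.
- by exists (y - 1); rewrite ?leNye// lte_fin gtrBl.
- by exists 0; rewrite ?leNye// ltry.
Qed.

(** The sublevel sets of [F] at its values on [A] are nested, so they form a
filter; by lower semicontinuity [F] is minimal at each cluster point of it in
[A]. Semicontinuity is only asked along [A], since the divergence is meaningful
on the orthant only. *)
Lemma compact_lsc_argmin (R : realType) (T : topologicalType) (A : set T)
    (F : T -> \bar R) :
    compact A -> A !=set0 ->
    (forall x, A x -> forall a : R, (a%:E < F x)%E ->
       \forall y \near x, A y -> (a%:E < F y)%E) ->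
  argmin A F !=set0.
Proof.
move=> cA [x0 Ax0] Flsc.
pose G := filter_from A (fun y => [set t | A t /\ (F t <= F y)%E]).
have FG : ProperFilter G.
  apply: filter_from_proper; last by move=> y Ay; exists y.
  apply: filter_from_filter; first by exists x0.
  move=> y y' Ay Ay'; have [yy'|yy'] := leP (F y) (F y').
    by exists y => // t [At ty]; split; split=> //; exact: le_trans yy'.
  by exists y' => // t [At ty]; split; split=> //; apply: le_trans (ltW yy').
have GA : G A by exists x0 => // t [].
have [x [Ax clx]] := cA G FG GA.
exists x; split=> // y Ay; rewrite leNgt; apply/negP => /lt_ereal_dense[a ya ax].
have Gy : G [set t | A t /\ (F t <= F y)%E] by exists y.
have [t [[At ty] /(_ At)]] := clx _ _ Gy (Flsc _ Ax _ ax).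
by rewrite ltNge (le_trans ty ya).
Qed.

Lemma continuous_trmx (R : realType) (m n : nat) :
  continuous (@trmx R m n).
Proof.
move=> A U /= [P nP PU]; exists (fun j i => P i j).
  by move=> j i; have := nP i j; rewrite mxE.
by move=> B hB; apply: PU => i j; rewrite mxE.
Qed.

Lemma compact_cV_box (R : realType) (n : nat) (lo hi : 'I_n -> R) :
  compact [set x : 'cV[R]_n | forall i, lo i <= x i 0 <= hi i].
Proof.
have -> : [set x : 'cV[R]_n | forall i, lo i <= x i 0 <= hi i] =
    trmx @` [set v : 'rV[R]_n | forall i, `[lo i, hi i]%classic (v ord0 i)].
  apply/seteqP; split => [x hx|_ [v hv <-] i] /=.
    exists x^T; last by rewrite trmxK.
    by move=> i; rewrite /= in_itv/= mxE.
  by have := hv i; rewrite /= in_itv/= mxE.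
apply: continuous_compact.
  by apply: continuous_subspaceT => x; exact: continuous_trmx.
apply: (@rV_compact R n (fun i => `[lo i, hi i]%classic)) => i.
exact: segment_compact.
Qed.

Lemma KL_lsc (R : realType) (m n : nat) (x r : 'M[R]_(m, n)) (e : R) :
  mx_orthant x -> mx_pos r -> 0 < e ->
  \forall y \near x, mx_orthant y -> KL x r - e < KL y r.
Proof.
move=> x0 r0 e0; pose d := e / (m * n).+1%:R.
have d0 : 0 < d by rewrite divr_gt0// ltr0n.
have near_entry : \forall y \near x, forall i j,
    0 <= (y : 'M[R]_(m, n)) i j -> kl (x i j) (r i j) - d < kl (y i j) (r i j).
  apply: (@filter_forall _ _ _ _ (nbhs_filter x)) => i.
  apply: (@filter_forall _ _ _ _ (nbhs_filter x)) => j.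
  have lt_d : kl (x i j) (r i j) - d < kl (x i j) (r i j) by rewrite gtrBl.
  exact: (@coord_continuous R m n i j x _ (kl_lsc (x0 i j) (r0 i j) lt_d)).
apply: filterS near_entry => y hy y0.
apply: (@lt_le_trans _ _ (\sum_i \sum_j (kl (x i j) (r i j) - d))).
  rewrite (_ : \sum_i _ = KL x r - d *+ (m * n)).
    rewrite ltrD2l ltrN2 -mulr_natr /d mulrAC ltr_pdivrMr ?ltr0n//.
    by rewrite ltr_pM2l// ltr_nat.
  under eq_bigr do rewrite big_split/= sumr_const card_ord.
  by rewrite big_split/= sumr_const card_ord -mulrnA mulNrn mulnC.
by apply: ler_sum2 => i j; rewrite ltW// hy.
Qed.

Lemma lsc_at (R : realType) (T : topologicalType) (g : T -> \bar R) (x : T)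
    (a : R) :
  lower_semicontinuous g -> (a%:E < g x)%E -> \forall y \near x, (a%:E < g y)%E.
Proof. by move=> gl /gl[V nV hV]; apply: filterS nV. Qed.

Lemma KL_add_lsc (R : realType) (m n : nat) (g : 'M[R]_(m, n) -> \bar R)
    (x r : 'M[R]_(m, n)) (a : R) :
    lower_semicontinuous g -> (forall x, g x != -oo%E) -> mx_pos r ->
    mx_orthant x -> (a%:E < (KL x r)%:E + g x)%E ->
  \forall y \near x, mx_orthant y -> (a%:E < (KL y r)%:E + g y)%E.
Proof.
move=> gl gN r0 x0; case gx : (g x) => [s| |] ax.
- rewrite -EFinD lte_fin in ax; pose e := (KL x r + s - a) / 2.
  have e0 : 0 < e by rewrite divr_gt0// subr_gt0.
  have : ((s - e)%:E < g x)%E by rewrite gx lte_fin gtrBl.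
  move=> /(lsc_at gl) h1; have h2 := KL_lsc x0 r0 e0.
  apply: filterS2 h1 h2 => y h1 h2 /h2 {}h2.
  apply: (@le_lt_trans _ _ ((KL y r)%:E + (s - e)%:E)%E); last by rewrite lteD2lE.
  by rewrite -EFinD lee_fin; move: h2; rewrite /e; lra.
- have : (a%:E < g x)%E by rewrite gx ltry.
  move=> /(lsc_at gl); apply: filterS => y ay y0.
  by apply: lt_le_trans ay _; rewrite leeDr// lee_fin KL_ge0.
- by have := gN x; rewrite gx.
Qed.

(** On the segment from [x0] to [p], a point within unit distance of [x0] lies
in a box on which lower semicontinuity bounds [g] from below; convexity
then bounds [g p] from below by an affine function of the distance to [x0]. *)
Lemma convex_lsc_lower_bound (R : realType) (n : nat)
    (g : 'cV[R]_n -> \bar R) (x0 : 'cV[R]_n) (s0 : R) :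
    convex_efunction g -> lower_semicontinuous g -> (forall x, g x != -oo%E) ->
    g x0 = s0%:E ->
  exists C D : R, 0 <= D /\
    forall p : 'cV[R]_n, ((C - D * \sum_i `|p i 0 - x0 i 0|)%:E <= g p)%E.
Proof.
move=> gc gl gN gx0.
pose B := [set x : 'cV[R]_n | forall i, x0 i 0 - 1 <= x i 0 <= x0 i 0 + 1].
have Bx0 : B x0 by move=> i; rewrite gerBl ler01 lerDl ler01.
have [x1 [_ hx1]] : argmin B g !=set0.
  apply: compact_lsc_argmin; [exact: compact_cV_box|by exists x0|].
  by move=> x _ a /(lsc_at gl); apply: filterS.
have [s1 gx1 s10] : exists2 s1, g x1 = s1%:E & s1 <= s0.
  have := hx1 _ Bx0; rewrite gx0; have := gN x1.
  by case: (g x1) => [s1| |]// _; rewrite lee_fin => s10; exists s1.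
exists s1, (s0 - s1); split=> [|p]; first by rewrite subr_ge0.
case gp : (g p) => [sp| |]; [|by rewrite leey|by have := gN p; rewrite gp].
set S := \sum_i _; have S0 : 0 <= S by exact: sumr_ge0.
have S1 : 0 < 1 + S by rewrite ltr_wpDr.
(* The shift by 1 keeps the step defined and at most 1 even when p = x0. *)
pose t := (1 + S)^-1.
have t0 : 0 < t by rewrite invr_gt0.
have t1 : t <= 1 by rewrite invf_le1// lerDl.
have By : B (t *: p + (1 - t) *: x0).
  move=> i; rewrite -ler_distl !mxE.
  rewrite (_ : _ - _ = t * (p i 0 - x0 i 0)); last by ring.
  rewrite normrM gtr0_norm// ler_pdivrMl// mulr1.
  rewrite /S (bigD1 i)//= addrCA lerDl.
  by rewrite addr_ge0// sumr_ge0.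
have := le_trans (hx1 _ By) (gc p x0 t _).
rewrite gx1 gp gx0 -!EFinM -EFinD !lee_fin ltW// => /(_ t1).
rewrite -(ler_pM2l S1) mulrDr !mulrA (mulrBr _ 1) mulr1 divff ?gt_eqF//; lra.
Qed.

(** The direct method: the superlinear growth of the divergence confines the
sublevel set of [x0] to a box, where a minimizer exists by compactness. The
positive point [x0] of the domain forces the minimizer into the interior, where
the first-order condition is available. *)
Lemma prox_KL_gt0_first_order (R : realType) (n : nat)
    (g : 'cV[R]_n -> \bar R) (r x0 : 'cV[R]_n) :
    convex_efunction g -> lower_semicontinuous g -> (forall x, g x != -oo%E) ->
    mx_pos x0 -> g x0 != +oo%E -> mx_pos r ->
  exists (p : 'cV[R]_n) (s : R), [/\ mx_pos p, g p = s%:E &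
    forall p', mx_orthant p' -> ((s - KL_slope p r p')%:E <= g p')%E].
Proof.
move=> gc gl gN x0_gt0 gx0oo r0.
have [s0 gx0] : exists s0, g x0 = s0%:E.
  by move: (gN x0) gx0oo; case: (g x0) => [s0| |]// _ _; exists s0.
have x0_ge0 : mx_orthant x0 by move=> i j; exact: ltW.
pose F p' := ((KL p' r)%:E + g p')%E.
have [C [D [D0 lbound]]] := convex_lsc_lower_bound gc gl gN gx0.
(* The Fenchel bound with slope D + 1 beats the affine bound on g, so F p is at
   least the sum of the entries of p, up to a constant. *)
pose X := \sum_i x0 i 0.
pose E := (\sum_i r i 0) * (expR (D + 1) - 1) + D * X - C.
have coercive p : mx_orthant p -> ((\sum_i p i 0 - E)%:E <= F p)%E.
  move=> p0; apply: le_trans (leeD2l _ (lbound p)).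
  rewrite -EFinD lee_fin.
  have h1 : (D + 1) * (\sum_i p i 0) - (\sum_i r i 0) * (expR (D + 1) - 1)
      <= KL p r.
    rewrite KLE mulr_sumr mulr_suml -sumrB; apply: ler_sum => i _.
    by rewrite big_ord1; exact: kl_fenchel.
  have h2 : \sum_i `|p i 0 - x0 i 0| <= \sum_i p i 0 + X.
    rewrite /X -big_split/=; apply: ler_sum => i _.
    by rewrite (le_trans (ler_normB _ _))// !ger0_norm.
  have := ler_wpM2l D0 h2; move: h1; rewrite /E; lra.
pose M := KL x0 r + s0 + E.
pose B := [set x : 'cV[R]_n | forall i, 0 <= x i 0 <= M].
have inB p : mx_orthant p -> (F p <= F x0)%E -> B p.
  move=> p0 pF i; rewrite p0/=; have := le_trans (coercive p p0) pF.
  rewrite /F gx0 -EFinD lee_fin lerBlDr -/M => /(le_trans _); apply.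
  by rewrite (bigD1 i)//= lerDl sumr_ge0.
have Borthant x : B x -> mx_orthant x.
  by move=> Bx i j; rewrite ord1; have /andP[] := Bx i.
have [p [Bp p_minB]] : argmin B F !=set0.
  apply: compact_lsc_argmin; first exact: compact_cV_box.
    by exists x0; exact: inB.
  move=> x /Borthant x_ge0 a ax.
  by apply: filterS (KL_add_lsc gl gN r0 x_ge0 ax) => y h /Borthant.
have p_ge0 := Borthant _ Bp.
have pF : (F p <= F x0)%E by apply: p_minB; exact: inB.
have p_min : argmin (@mx_orthant R n 1) F p.
  split=> // y y0; have [yF|/ltW yF] := leP (F y) (F x0).
    by apply: p_minB; exact: inB.
  exact: le_trans pF yF.
have [s gp] : exists s, g p = s%:E.
  move: pF (gN p); rewrite /F gx0 -EFinD.
  by case: (g p) => [s| |]// _ _; exists s.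
have p_gt0 := argmin_KL_gt0 r0 p_ge0 gp p_min gc x0_gt0 gx0.
exists p, s; split=> //; exact: argmin_KL_first_order.
Qed.

(** * The two proximal maps of the algorithm *)

(** Along each column of the rescaled matrix the ratio to [r] is constant, so its
logarithm pairs to zero with differences of matrices with equal column sums. *)
Lemma prox_phi1 (R : realType) (N : nat) (q : 'cV[R]_N) (r : 'M[R]_N) :
  mx_pos q -> mx_pos r ->
  prox_KL (phi1 q) r = \matrix_(i, j) (r i j * (q j 0 / \sum_k r k j)).
Proof.
move=> q0 r0; set p := \matrix_(i, j) _.
have S0 j : 0 < \sum_k r k j.
  rewrite (bigD1 j)//= ltr_wpDr// sumr_ge0// => k _; exact: ltW.
have phi1E (p' : 'M[R]_N) : (p'^T *m const_mx 1 == q) -> forall j, \sum_i p' i j = q j 0.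
  move=> /eqP <- j; rewrite !mxE; apply: eq_bigr => i _.
  by rewrite !mxE mulr1.
have pq : p^T *m const_mx 1 = q.
  apply/matrixP => j k; rewrite (ord1 k) mxE.
  under eq_bigr do rewrite !mxE mulr1.
  by rewrite -mulr_suml mulrCA divff ?mulr1// gt_eqF.
apply: (@prox_KL_first_order _ _ _ _ _ _ 0) => //.
- by move=> i j; rewrite mxE mulr_gt0// divr_gt0.
- by rewrite /phi1 pq eqxx.
move=> p' p'0; rewrite /phi1; case: ifPn => [/phi1E p'q|_]; last by rewrite leey.
rewrite lee_fin sub0r oppr_le0 /KL_slope exchange_big/=.
apply: sumr_ge0 => j _.
rewrite (eq_bigr (fun i => (p' i j - p i j) * ln (q j 0 / \sum_k r k j))).
  by rewrite -mulr_suml sumrB p'q (phi1E p) ?pq// subrr mul0r.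
by move=> i _; rewrite [p i j]mxE mulrAC divff ?mul1r// gt_eqF.
Qed.

(** Scaling the rows of [r] keeps the ratio to [r] constant along each row, so
that the slope of the matrix divergence is the slope of the vector divergence
between the row sums. *)
Lemma prox_row_sums (R : realType) (N : nat) (g : 'cV[R]_N -> \bar R)
    (r : 'M[R]_N) (p : 'cV[R]_N) (s : R) :
    mx_pos r -> mx_pos p -> g p = s%:E ->
    (forall p', mx_orthant p' ->
       ((s - KL_slope p (r *m const_mx 1) p')%:E <= g p')%E) ->
  prox_KL (fun A => g (A *m const_mx 1)) r =
    \matrix_(i, j) (r i j * (p i 0 / \sum_k r i k)).
Proof.
move=> r0 p0 gp first_order; set P := \matrix_(i, j) _.
have row_sum (A : 'M[R]_N) i :
    (A *m const_mx 1 : 'cV[R]_N) i 0 = \sum_j A i j.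
  by rewrite mxE; apply: eq_bigr => j _; rewrite mxE mulr1.
have S0 i : 0 < \sum_k r i k.
  by rewrite (bigD1 i)//= ltr_wpDr// sumr_ge0// => k _; exact: ltW.
have Pp : P *m const_mx 1 = p.
  apply/matrixP => i k; rewrite (ord1 k) row_sum.
  under eq_bigr do rewrite !mxE.
  by rewrite -mulr_suml mulrCA divff ?mulr1// gt_eqF.
apply: (@prox_KL_first_order _ _ _ _ _ _ s) => //.
- by move=> i j; rewrite mxE mulr_gt0// divr_gt0.
- by rewrite Pp.
move=> A A0.
have A1 : mx_orthant (A *m const_mx 1 : 'cV[R]_N).
  by move=> i k /=; rewrite (ord1 k) row_sum; exact: sumr_ge0.
rewrite (_ : KL_slope P r A = KL_slope p (r *m const_mx 1) (A *m const_mx 1)).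
  exact: first_order.
apply: eq_bigr => i _.
have pE : \sum_j P i j = p i 0 by rewrite -(row_sum P) Pp.
rewrite big_ord1 !row_sum -[X in _ - X]pE -sumrB mulr_suml.
by apply: eq_bigr => j _; rewrite [P i j]mxE mulrAC divff ?mul1r// gt_eqF.
Qed.

Section scaled_function.
Context (R : realType) (n : nat) (c : R) (f : 'cV[R]_n -> \bar R).
Context (c0 : 0 < c).

Lemma scale_Nninfty x : f x != -oo%E -> (c%:E * f x)%E != -oo%E.
Proof.
by case: (f x) => [y| |]// _; rewrite -?EFinM// gt0_muley// lte_fin.
Qed.

Lemma scale_convex : (forall x, f x != -oo%E) ->
  convex_efunction f -> convex_efunction (fun x => c%:E * f x)%E.
Proof.
move=> fN fc x y t t01.
have weightN w z : 0 <= w -> (w%:E * f z != -oo)%E.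
  rewrite le_eqVlt => /predU1P[<-|w0]; first by rewrite mul0e.
  case fz : (f z) => [v| |]//; first by rewrite gt0_muley// lte_fin.
  by have := fN z; rewrite fz.
have /andP[t0 t1] := t01.
rewrite [leRHS](_ : _ = c%:E * (t%:E * f x + (1 - t)%:E * f y))%E.
  by apply: lee_wpmul2l (fc x y t t01); rewrite lee_fin ltW.
rewrite muleDr//; first by rewrite ![(c%:E * (_ * _))%E]muleCA.
by rewrite /adde_def !negb_and !weightN ?orbT// subr_ge0.
Qed.

Lemma scale_lsc : lower_semicontinuous f ->
  lower_semicontinuous (fun x => c%:E * f x)%E.
Proof.
move=> fl x a; rewrite -lte_pdivrMl// => /fl[V nV hV].
by exists V => // y /hV; rewrite EFinM lte_pdivrMl.
Qed.

End scaled_function.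

Lemma relative_interior_orthant_gt0 (R : realType) (m n : nat)
    (X : 'M[R]_(m, n)) :
  relative_interior (@mx_orthant R m n) X -> mx_pos X.
Proof.
move=> [X0 nX] i j.
pose line (e : R) : 'M[R]_(m, n) := X - const_mx e.
have line_hull e : 0 < e -> affine_hull (@mx_orthant R m n) (line e).
  (* X - e = 2 X - (X + e), an affine combination of two points of the orthant *)
  move=> e0; exists 2%N, (fun k => if k == 0 then 2 else -1),
    (fun k => if k == 0 then X else X + const_mx e); split.
  - move=> k; case: ifP => _ //.
    by move=> i' j'; rewrite !mxE addr_ge0// ltW.
  - by rewrite !big_ord_recl big_ord0/=; ring.
  - rewrite !big_ord_recl big_ord0/= addr0 scaleN1r scaler_nat mulr2n.
    by rewrite opprD addrA addrK.
have near_line : \forall e \near (0 : R), affine_hull (@mx_orthant R m n) (line e) ->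
    mx_orthant (line e).
  case: nX => V nV VX.
  suff : \forall e \near (0 : R), forall i j, V i j (X i j - e).
    apply: filterS => e hV; apply: VX => i' j'.
    by have := hV i' j'; rewrite !mxE.
  apply: (@filter_forall _ _ _ _ (nbhs_filter (0 : R))) => i'.
  apply: (@filter_forall _ _ _ _ (nbhs_filter (0 : R))) => j'.
  have cX : (fun e : R => X i' j' - e) @ (0 : R) --> X i' j'.
    by rewrite -[X in _ --> X]subr0; apply: cvgB; [exact: cvg_cst|exact: cvg_id].
  exact: cX _ (nV i' j').
have /nbhs_ballP[d /= d0 hd] := near_line.
have d20 : 0 < d / 2 by rewrite divr_gt0.
have : mx_orthant (line (d / 2)).
  apply: hd (line_hull _ d20).
  rewrite /ball/= sub0r normrN gtr0_norm//; lra.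
move=> /(_ i j); rewrite !mxE subr_ge0; exact: lt_le_trans.
Qed.

(** * The scaling form of the iterates *)

Lemma diag_scalingE (R : realType) (N : nat) (a b : 'cV[R]_N) (xi : 'M[R]_N) i j :
  (diag_mx a^T *m xi *m diag_mx b^T) i j = a i 0 * xi i j * b j 0.
Proof. by rewrite mul_mx_diag mxE mul_diag_mx !mxE. Qed.

Lemma outerE (R : realType) (N : nat) (u v : 'cV[R]_N) i j :
  (u *m v^T) i j = u i 0 * v j 0.
Proof. by rewrite mxE big_ord1 mxE. Qed.

(** The scaling vectors of two consecutive steps: [uc], [vc] are those of the
current step and [up], [vp] those of the preceding one, which suffices to run
a recursion of depth two. *)
Record scaling (R : realType) (N : nat) := Scaling {
  sa : 'cV[R]_N; sb : 'cV[R]_N;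
  uc : 'cV[R]_N; vc : 'cV[R]_N; up : 'cV[R]_N; vp : 'cV[R]_N }.

Section scaling_recursion.
Context (R : realType) (N : nat) (xi : 'M[R]_N) (q : 'cV[R]_N).
Context (g : 'cV[R]_N -> \bar R).

Definition scaling_step (l : nat) (s : scaling R N) : scaling R N :=
  let b_even := sb s ⊙ vp s in
  let a := if odd l then sa s ⊙ up s
    else prox_KL g (sa s ⊙ up s ⊙ (xi *m b_even)) ⊘ (xi *m b_even) in
  let b := if odd l then q ⊘ (xi^T *m a) else b_even in
  Scaling a b (up s ⊙ (sa s ⊘ a)) (vp s ⊙ (sb s ⊘ b)) (uc s) (vc s).

Fixpoint scaling_at (l : nat) : scaling R N :=
  if l is k.+1 then scaling_step k.+1 (scaling_at k)
  else let e := const_mx 1 in Scaling e e e e e e.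

Definition scaling_pos (s : scaling R N) : Prop :=
  [/\ mx_pos (sa s), mx_pos (sb s), mx_pos (uc s) & mx_pos (vc s)] /\
  (mx_pos (up s) /\ mx_pos (vp s)).

Context (xi0 : mx_pos xi) (q0 : mx_pos q) (x0 : 'cV[R]_N).
Context (g_convex : convex_efunction g) (g_lsc : lower_semicontinuous g).
Context (gN : forall x, g x != -oo%E).
Context (x0_gt0 : mx_pos x0) (gx0 : g x0 != +oo%E).

Let mulmx_gt0 (A : 'M[R]_N) (x : 'cV[R]_N) :
  mx_pos A -> mx_pos x -> mx_pos (A *m x).
Proof.
move=> A0 x_gt0 i j; rewrite mxE (bigD1 i)//= ltr_wpDr//; last exact: mulr_gt0.
by apply: sumr_ge0 => k _; rewrite mulr_ge0// ltW.
Qed.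

Let map2_gt0 (m : nat) (op : R -> R -> R) (A B : 'M[R]_(N, m)) :
  (forall x y, 0 < x -> 0 < y -> 0 < op x y) ->
  mx_pos A -> mx_pos B -> mx_pos (map2_mx op A B).
Proof. by move=> op0 A0 B0 i j; rewrite mxE op0. Qed.

Let mul_gt0 (m : nat) (A B : 'M[R]_(N, m)) : mx_pos A -> mx_pos B -> mx_pos (A ⊙ B).
Proof. by apply: map2_gt0 => x y; exact: mulr_gt0. Qed.

Let div_gt0 (m : nat) (A B : 'M[R]_(N, m)) : mx_pos A -> mx_pos B -> mx_pos (A ⊘ B).
Proof. by apply: map2_gt0 => x y; exact: divr_gt0. Qed.

Let prox_gt0 (r : 'cV[R]_N) : mx_pos r -> mx_pos (prox_KL g r).
Proof.
move=> r0; have [p [s [p0 gp first_order]]] :=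
  prox_KL_gt0_first_order g_convex g_lsc gN x0_gt0 gx0 r0.
by rewrite (prox_KL_first_order r0 p0 gp first_order).
Qed.

Lemma scaling_step_pos l s : scaling_pos s -> scaling_pos (scaling_step l s).
Proof.
move=> [[a0 b0 u0 v0] [u'0 v'0]].
have xiT0 : mx_pos xi^T by move=> i j; rewrite mxE.
have a1 : mx_pos (sa (scaling_step l s)).
  rewrite /scaling_step/=; case: ifP => _; first exact: mul_gt0.
  apply: div_gt0; last by apply: mulmx_gt0 => //; exact: mul_gt0.
  apply: prox_gt0; apply: mul_gt0; first exact: mul_gt0.
  by apply: mulmx_gt0 => //; exact: mul_gt0.
have b1 : mx_pos (sb (scaling_step l s)).
  move: a1; rewrite /scaling_step/=; case: ifP => _ a1; last exact: mul_gt0.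
  by apply: div_gt0 => //; exact: mulmx_gt0.
by split; split => //; apply: mul_gt0 => //; exact: div_gt0.
Qed.

Lemma scaling_at_pos l : scaling_pos (scaling_at l).
Proof.
elim: l => [|l ih]; last exact: scaling_step_pos.
by split; split => i j; rewrite mxE.
Qed.

Let scaled s := diag_mx (sa s)^T *m xi *m diag_mx (sb s)^T.

(** One step of the algorithm preserves the scaling form: the product of the
current iterate with the rank-one correction is again a scaling of [xi], and
both proximal maps only rescale rows or columns. *)
Lemma prox_scaling_step l s : scaling_pos s ->
  prox_KL (if odd l then phi1 q else fun A => g (A *m const_mx 1))
    (scaled s ⊙ (up s *m (vp s)^T)) = scaled (scaling_step l s).
Proof.
move=> s0; have [[a0 b0 _ _] [u0 v0]] := s0.
set r := scaled s ⊙ _.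
have rE i j : r i j = (sa s ⊙ up s) i 0 * xi i j * (sb s ⊙ vp s) j 0.
  by rewrite mxE diag_scalingE outerE !mxE; ring.
have au0 : mx_pos (sa s ⊙ up s) by exact: mul_gt0.
have bv0 : mx_pos (sb s ⊙ vp s) by exact: mul_gt0.
have r0 : mx_pos r by move=> i j; rewrite rE !mulr_gt0.
have xiT0 : mx_pos xi^T by move=> i j; rewrite mxE.
have [[a1 b1 _ _] _] := scaling_step_pos l s0.
move: a1 b1; rewrite /scaled /scaling_step/=; case: ifP => _ a1 b1.
  rewrite prox_phi1//; apply/matrixP => i j; rewrite mxE diag_scalingE.
  have D0 := mulmx_gt0 xiT0 au0.
  have -> : \sum_k r k j = (xi^T *m (sa s ⊙ up s)) j 0 * (sb s ⊙ vp s) j 0.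
    rewrite [(_ *m _) j 0]mxE mulr_suml; apply: eq_bigr => k _.
    by rewrite rE [xi^T j k]mxE; ring.
  rewrite rE [(q ⊘ _) j 0]mxE.
  by field; rewrite !gt_eqF.
have D0 := mulmx_gt0 xi0 bv0.
set w := sa s ⊙ up s ⊙ _.
have rw : r *m const_mx 1 = w.
  apply/matrixP => i k; rewrite (ord1 k) [w i 0]mxE [(xi *m _) i 0]mxE mulr_sumr mxE.
  by apply: eq_bigr => j _; rewrite rE !mxE; ring.
have w0 : mx_pos w by exact: mul_gt0.
have [p [t [p0 gp first_order]]] :=
  prox_KL_gt0_first_order g_convex g_lsc gN x0_gt0 gx0 w0.
rewrite (prox_KL_first_order w0 p0 gp first_order).
rewrite -rw in first_order.
rewrite (prox_row_sums r0 p0 gp first_order).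
apply/matrixP => i j; rewrite mxE diag_scalingE.
have -> : \sum_k r i k = (sa s ⊙ up s) i 0 * (xi *m (sb s ⊙ vp s)) i 0.
  rewrite [(_ *m _) i 0]mxE mulr_sumr; apply: eq_bigr => k _.
  by rewrite rE; ring.
rewrite rE [(p ⊘ _) i 0]mxE.
by field; rewrite !gt_eqF.
Qed.

(** The entries of [xi] cancel in the quotient of two scalings of [xi], which
leaves a matrix of rank one. *)
Lemma correction_scaling_step l s : scaling_pos s ->
  (up s *m (vp s)^T) ⊙ (scaled s ⊘ scaled (scaling_step l s)) =
  uc (scaling_step l s) *m (vc (scaling_step l s))^T.
Proof.
move=> s0; have [[a0 b0 _ _] [u0 v0]] := s0.
have [[a1 b1 _ _] _] := scaling_step_pos l s0.
apply/matrixP => i j.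
rewrite mxE [(_ ⊘ _) i j]mxE /scaled !diag_scalingE !outerE.
rewrite [uc _ i 0]mxE [vc _ j 0]mxE ![(_ ⊘ _) _ 0]mxE.
rewrite -/(sa (scaling_step l s)) -/(sb (scaling_step l s)).
by field; rewrite !gt_eqF.
Qed.

(** The invariant carries the corrections at two consecutive indices, because
each step uses the older one. *)
Lemma scaling_iterates (P : nat -> 'M[R]_N) (z : int -> 'M[R]_N) :
  dykstra_iterates (phi1 q) (fun A => g (A *m const_mx 1)) xi P z ->
  forall l, let s := scaling_at l in
  [/\ P l = scaled s, z l%:Z = uc s *m (vc s)^T &
      z (l%:Z - 1) = up s *m (vp s)^T].
Proof.
move=> [P0 z0 z1 step]; elim=> [|l [Pl zl zl1]]/=.
  have one : const_mx 1 = const_mx 1 *m (const_mx 1 : 'cV[R]_N)^T :> 'M[R]_N.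
    by apply/matrixP => i j; rewrite outerE !mxE mulr1.
  rewrite z0 sub0r z1 P0 -one; split=> //.
  by apply/matrixP => i j; rewrite diag_scalingE !mxE mul1r mulr1.
have [Pl1 zSl] := step l.+1 isT.
have e1 : l.+1%:Z - 1 = l%:Z by rewrite -addn1 PoszD addrK.
have e2 : l.+1%:Z - 2 = l%:Z - 1 by rewrite -addn1 PoszD -addrA.
rewrite e2 -[l.+1.-1]/l Pl zl1 in Pl1 zSl.
rewrite (prox_scaling_step _ (scaling_at_pos l)) in Pl1.
split=> //; last by rewrite e1.
by rewrite zSl Pl1 correction_scaling_step//; exact: scaling_at_pos.
Qed.

End scaling_recursion.
Theorem proposition3p3 (R : realType) (N : nat) (tau gamma : R)
    (c xi : 'M[R]_N) (q : 'cV[R]_N) (f : 'cV[R]_N -> \bar R)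
    (P : nat -> 'M[R]_N) (z : int -> 'M[R]_N)
    (tau_gt0 : 0 < tau) (gamma_gt0 : 0 < gamma)
    (xiE : xi = map_mx (fun x => expR (- x / gamma)) c)
    (q_ge0 : @mx_orthant R N 1 q) (q_sum1 : \sum_i q i 0 = 1)
    (f_proper : proper_function f)
    (f_lsc : lower_semicontinuous f)
    (f_convex : convex_efunction f)
    (qualification :
       relative_interior (effective_domain (phi1 q))
       `&` relative_interior (effective_domain (phi2 tau gamma f))
       `&` relative_interior (@mx_orthant R N N) !=set0)
    (dykstra : dykstra_iterates (phi1 q) (phi2 tau gamma f) xi P z) :
  exists (a b : nat -> 'cV[R]_N) (u v : int -> 'cV[R]_N),
    (* initialization *)
    [/\ a 0%N = const_mx 1, b 0%N = const_mx 1, u 0 = const_mx 1,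
        v 0 = const_mx 1 & u (-1) = const_mx 1 /\ v (-1) = const_mx 1]
    (* updates *)
    /\ (forall l : nat, (0 < l)%N ->
          (odd l ->
             a l = a l.-1 ⊙ u (l%:Z - 2)
             /\ b l = q ⊘ (xi^T *m a l))
          /\ (~~ odd l ->
             b l = b l.-1 ⊙ v (l%:Z - 2)
             /\ exists p : 'cV[R]_N,
                  p = prox_KL (fun x => ((tau / gamma)%:E * f x)%E)
                              (a l.-1 ⊙ u (l%:Z - 2) ⊙ (xi *m b l))
                  /\ a l = p ⊘ (xi *m b l))
          /\ u l%:Z = u (l%:Z - 2) ⊙ (a l.-1 ⊘ a l)
          /\ v l%:Z = v (l%:Z - 2) ⊙ (b l.-1 ⊘ b l))
    (* positivity and factorization of the iterates *)
    /\ (forall l : nat,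
          [/\ mx_pos (a l), mx_pos (b l), mx_pos (u l%:Z) & mx_pos (v l%:Z)]
          /\ P l = diag_mx (a l)^T *m xi *m diag_mx (b l)^T
          /\ z l%:Z = u l%:Z *m (v l%:Z)^T).
Proof.
have fN := f_proper.1.
have c0 : 0 < tau / gamma by rewrite divr_gt0.
have [X [[[X1 _] [X2 _]] /relative_interior_orthant_gt0 X0]] := qualification.
have xi0 : mx_pos xi by move=> i j; rewrite xiE mxE expR_gt0.
have sum_gt0 (F : 'I_N -> R) (i : 'I_N) : (forall k, 0 < F k) -> 0 < \sum_k F k.
  by move=> F0; rewrite (bigD1 i)//= ltr_wpDr// sumr_ge0// => k _; exact: ltW.
have q0 : mx_pos q.
  move: X1; rewrite /effective_domain/= /phi1; case: ifP => // /eqP <- _ i j.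
  by rewrite mxE; apply: sum_gt0 => // k; rewrite !mxE mulr1.
pose g x := ((tau / gamma)%:E * f x)%E.
have x0_gt0 : mx_pos (X *m const_mx 1 : 'cV[R]_N).
  by move=> i j; rewrite mxE; apply: sum_gt0 => // k; rewrite !mxE mulr1.
have gx0 : g (X *m const_mx 1) != +oo%E by [].
have gN x : g x != -oo%E by exact: scale_Nninfty.
have gc : convex_efunction g by exact: scale_convex.
have gl : lower_semicontinuous g by exact: scale_lsc.
pose st := scaling_at xi q g.
(* The only negative index in the recursion is -1, where u and v are 1. *)
pose at_int (F : scaling R N -> 'cV[R]_N) (k : int) : 'cV[R]_N :=
  if k is Posz l then F (st l) else const_mx 1.
have previous (F G : scaling R N -> 'cV[R]_N) l :
    (forall k, G (st k.+1) = F (st k)) -> G (st 0%N) = const_mx 1 ->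
    at_int F (l.+1%:Z - 2) = G (st l).
  move=> FG G0; case: l => [|l]; first by rewrite G0.
  by rewrite FG (_ : l.+2%:Z - 2 = l%:Z)// -addn2 PoszD addrK.
exists (fun l => sa (st l)), (fun l => sb (st l)), (at_int (@uc R N)),
  (at_int (@vc R N)); split; [by split|split].
  case=> // l _; rewrite (previous (@uc R N) (@up R N))//.
  rewrite (previous (@vc R N) (@vp R N))//=; split; first by move=> ->.
  split; last by [].
  move=> /negbTE ol; rewrite ol; split=> //.
  by eexists; split; first exact: erefl.
move=> l.
have [[a0 b0 u0 v0] _] := scaling_at_pos xi0 q0 gc gl gN x0_gt0 gx0 l.
have [Pl zl _] := scaling_iterates xi0 q0 gc gl gN x0_gt0 gx0 dykstra l.
by split.
Qed.
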